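(* Let $X$ be a second countable Baire complex topological vector space and $\Gamma$ a subset of $L(X)$. If $\Gamma$ satisfies the criterion of codiskcyclicity, then $\mathbb{U}C(\Gamma)$ is a dense subset of $X$. As a consequence, $\Gamma$ is codiskcyclic.
   Context: $L(X)$ is the set of all continuous linear operators on $X$. Put $\mathbb{U}=\{\alpha\in\mathbb{C} : |\alpha|\geq 1\}$. For $\Gamma\subset L(X)$ and $x\in X$, the codisk orbit of $x$ under $\Gamma$ is $\mathbb{U}Orb(\Gamma,x)=\{\alpha Tx : \alpha\in\mathbb{U},\ T\in\Gamma\}$. The vector $x$ is a codiskcyclic vector for $\Gamma$ if $\mathbb{U}Orb(\Gamma,x)$ is dense in $X$; the set of all codiskcyclic vectors for $\Gamma$ is denoted $\mathbb{U}C(\Gamma)$, and $\Gamma$ is codiskcyclic if $\mathbb{U}C(\Gamma)\neq\emptyset$. $\Gamma$ satisfies the criterion of codiskcyclicity if there exist two dense subsets $X_0$ and $Y_0$ of $X$, a sequence $\{\alpha_k\}$ in $\mathbb{U}$, a sequence $\{T_k\}$ in $\Gamma$ and a sequence of maps $S_k: Y_0\to X$ such that: (i) $\alpha_k T_k x\to 0$ for all $x\in X_0$; (ii) $\alpha_k^{-1}S_k y\to 0$ for all $y\in Y_0$; (iii) $T_kS_k y\to y$ for all $y\in Y_0$. *)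

(* Defs.v *)
From mathcomp Require Export all_boot all_order all_algebra.
From mathcomp Require Export complex.
From mathcomp Require Export all_classical all_reals all_analysis.
Export numFieldNormedType.Exports.

Set Implicit Arguments.
Unset Strict Implicit.
Unset Printing Implicit Defensive.

Local Open Scope classical_set_scope.
Local Open Scope ring_scope.

Definition baire_space (X : topologicalType) : Prop :=
  forall F : (set X)^nat,
    (forall n, open (F n) /\ dense (F n)) -> dense (\bigcap_n F n).

(* The norm of R[i] takes its values in R[i] itself; 1 <= `|a| holds exactly
   when the modulus of a is at least 1. *)
Definition unit_codisk (R : realType) : set R[i] := [set a | 1 <= `|a|].

Section Codiskcyclicity.
Context {R : realType} {X : topologicalLmodType R[i]}.

Definition continuous_operators : set {linear X -> X} :=
  [set T | continuous T].

Definition codisk_orbit (Gamma : set {linear X -> X}) (x : X) : set X :=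
  [set y | exists a : R[i], exists T : {linear X -> X},
    [/\ unit_codisk a, Gamma T & y = a *: T x]].

Definition codiskcyclic_vectors (Gamma : set {linear X -> X}) : set X :=
  [set x | dense (codisk_orbit Gamma x)].

Definition codiskcyclic (Gamma : set {linear X -> X}) : Prop :=
  codiskcyclic_vectors Gamma !=set0.

(* Each S k is a bare map, neither linear nor continuous, defined on the subset
   Y0 only (Y0 is coerced to the subtype of its elements). *)
Definition codiskcyclicity_criterion (Gamma : set {linear X -> X}) : Prop :=
  exists (X0 Y0 : set X) (alpha : nat -> R[i]) (T : nat -> {linear X -> X})
      (S : nat -> Y0 -> X),
    [/\ dense X0 /\ dense Y0,
        (forall k, unit_codisk (alpha k)) /\ (forall k, Gamma (T k)),
        forall x, X0 x -> (alpha k *: T k x) @[k --> \oo] --> (0 : X),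
        forall y : Y0, ((alpha k)^-1 *: S k y) @[k --> \oo] --> (0 : X) &
        forall y : Y0, T k (S k y) @[k --> \oo] --> (\val y : X)].

End Codiskcyclicity.

(* Main.v *)
Require Import Defs.
Import Order.TTheory GRing.Theory Num.Theory.

Set Implicit Arguments.
Unset Strict Implicit.
Unset Printing Implicit Defensive.

Local Open Scope classical_set_scope.
Local Open Scope ring_scope.

(** The proof is the Birkhoff transitivity argument.  Consider the family
    [codisk_maps Gamma] of all maps [a *: T] with [1 <= `|a|] and [T] in
    [Gamma]; the codisk orbit of [x] is the set of values at [x] of this family.

    The criterion makes the family topologically transitive: some map of the
    family sends a point of any prescribed nonempty open set [U] into any
    prescribed nonempty open set [V] ([criterion_transitive]).  Indeed, take
    [x] in [X0] and [U], [y] in [Y0] and [V], and put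
    [z_k = x + alpha_k^-1 *: S_k y].  Then [z_k] tends to [x] because the
    correction tends to 0, and, by linearity of [T_k],
    [alpha_k *: T_k z_k = alpha_k *: T_k x + T_k (S_k y)] tends to [0 + y]; so
    for large [k] the point [z_k] is in [U] and its image is in [V].

    On a second countable Baire space, any transitive family of continuous maps
    has a dense set of points with dense orbit ([transitive_dense_orbits]): a
    point has dense orbit as soon as its orbit meets every nonempty member of a
    countable basis, and for each such member the points whose orbit meets it
    form an open set, which is dense by transitivity. *)

(** * Transitive families of continuous maps on a Baire space *)

Lemma subset_dense (X : topologicalType) (A B : set X) :
  A `<=` B -> dense A -> dense B.
Proof.
move=> AB A_dense O O_neq0 O_open.
have [x [Ox Ax]] := A_dense O O_neq0 O_open.
by exists x; split => //; exact: AB.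
Qed.

Lemma baire_countable_bigcap (X : topologicalType) (X_baire : baire_space X)
    (I : Type) (A : set I) (F : I -> set X) :
  countable A -> (forall i, A i -> open (F i) /\ dense (F i)) ->
  dense (\bigcap_(i in A) F i).
Proof.
move=> /pfcard_geP[->|[f]] F_open_dense.
  by rewrite bigcap_set0 => O O_neq0 _; rewrite setIT.
have fA n : A (f n) by exact: funS.
apply: (subset_dense (A := \bigcap_n F (f n))); last first.
  by apply: X_baire => n; exact: F_open_dense.
move=> x Fx i Ai.
have [n _ <-] : (f @` setT) i by exact: surj.
exact: Fx.
Qed.

Definition map_orbit (X Y : Type) (F : set (X -> Y)) (x : X) : set Y :=
  [set y | exists2 f, F f & y = f x].

Definition transitive_family (X Y : topologicalType) (F : set (X -> Y)) :=
  forall (U : set X) (V : set Y),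
    open U -> U !=set0 -> open V -> V !=set0 ->
    exists2 x, U x & map_orbit F x `&` V !=set0.

Lemma dense_basis (X : topologicalType) (B : set (set X)) (A : set X) :
  basis B -> (forall V, B V -> V !=set0 -> A `&` V !=set0) -> dense A.
Proof.
move=> [_ B_nbhs] A_meets O [x Ox] O_open.
have [V [BV Vx] VO] := B_nbhs x O (open_nbhs_nbhs (conj O_open Ox)).
have [y [Ay Vy]] := A_meets V BV (ex_intro _ x Vx).
by exists y; split => //; exact: VO.
Qed.

Lemma open_orbit_meets (X Y : topologicalType) (F : set (X -> Y)) (V : set Y) :
  (forall f, F f -> continuous f) -> open V ->
  open [set x | map_orbit F x `&` V !=set0].
Proof.
move=> F_cont V_open.
have -> : [set x | map_orbit F x `&` V !=set0] = \bigcup_(f in F) (f @^-1` V).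
  apply/seteqP; split => [x [_ [[f Ff ->] Vfx]]|x [f Ff Vfx]].
    by exists f.
  by exists (f x); split => //; exists f.
by apply: bigcup_open => f /F_cont /continuousP; exact.
Qed.

(** Birkhoff's transitivity theorem: the points with dense orbit contain the
    intersection, over the nonempty members [V] of a countable basis, of the
    sets of points whose orbit meets [V]. *)
Theorem transitive_dense_orbits (X Y : topologicalType) (F : set (X -> Y)) :
  baire_space X -> @second_countable Y -> (forall f, F f -> continuous f) ->
  transitive_family F -> dense [set x | dense (map_orbit F x)].
Proof.
move=> X_baire [B B_countable B_basis] F_cont F_trans.
pose B' := B `&` [set V | V !=set0].
pose meets V := [set x | map_orbit F x `&` V !=set0].
apply: (subset_dense (A := \bigcap_(V in B') meets V)).
  move=> x x_meets; apply: (dense_basis B_basis) => V BV V_neq0.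
  by apply: x_meets.
apply: baire_countable_bigcap => // [|V [BV V_neq0]].
  by apply: sub_countable B_countable; apply: subset_card_le => V [].
have V_open : open V by exact: B_basis.1.
split; first exact: open_orbit_meets.
move=> U U_neq0 U_open.
by have [x Ux x_meets] := F_trans U V U_open U_neq0 V_open V_neq0; exists x.
Qed.

(** * The codisk family *)

Lemma scaler_continuous (K : numDomainType) (X : topologicalLmodType K)
    (a : K) :
  continuous (fun x : X => a *: x).
Proof.
move=> x; apply: (@continuous_comp _ (K^o * X)%type _ (fun y => (a, y))
  (fun z => z.1 *: z.2)); last exact: scale_continuous.
exact: cvg_pair (cvg_cst _) cvg_id.
Qed.

Lemma topological_cvgD (X : topologicalZmodType) (I : Type) (F : set_system I)
    (F_filter : Filter F) (f g : I -> X) (a b : X) :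
  f @ F --> a -> g @ F --> b -> (f i + g i) @[i --> F] --> a + b.
Proof.
move=> fa gb; apply: continuous2_cvg fa gb.
exact: (@add_continuous X (a, b)).
Qed.

Section Codisk.
Context {R : realType} {X : topologicalLmodType R[i]}.
Implicit Types Gamma : set {linear X -> X}.

Definition codisk_maps Gamma : set (X -> X) :=
  [set f | exists a (T : {linear X -> X}),
    [/\ unit_codisk a, Gamma T & f = fun x => a *: T x]].

Lemma codisk_orbitE Gamma (x : X) :
  codisk_orbit Gamma x = map_orbit (codisk_maps Gamma) x.
Proof.
apply/seteqP; split => [_ [a [T [a_ge1 GT ->]]]|_ [_ [a [T [a_ge1 GT ->]]] ->]].
  by exists (fun z => a *: T z) => //; exists a, T.
by exists a, T.
Qed.

Lemma codisk_maps_continuous Gamma : Gamma `<=` continuous_operators ->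
  forall f, codisk_maps Gamma f -> continuous f.
Proof.
move=> Gamma_sub _ [a [T [_ GT ->]]] x.
by apply: (continuous_comp (g := fun x => a *: x));
  [exact: Gamma_sub | exact: scaler_continuous].
Qed.

(** The correction [alpha_k^-1 *: S_k y] to [x] is small, yet [alpha_k *: T_k]
    sends it close to [y]: the two scalars cancel. *)
Lemma criterion_transitive Gamma :
  codiskcyclicity_criterion Gamma -> transitive_family (codisk_maps Gamma).
Proof.
move=> [X0 [Y0 [alpha [T [S [[X0_dense Y0_dense] [alpha_ge1 GT]
  alphaT_0 alphaS_0 TS_id]]]]]] U V U_open U_neq0 V_open V_neq0.
have [x [Ux X0x]] := X0_dense U U_neq0 U_open.
have [y [Vy Y0y]] := Y0_dense V V_neq0 V_open.
pose y0 : Y0 := exist _ y (mem_set Y0y).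
pose z k := x + (alpha k)^-1 *: S k y0.
have alpha_neq0 k : alpha k != 0.
  by rewrite -normr_gt0; exact: lt_le_trans ltr01 (alpha_ge1 k).
have z_x : z @ \oo --> x.
  rewrite -[x in _ --> x]addr0.
  by apply: topological_cvgD (alphaS_0 y0); exact: cvg_cst.
have Tz_y : (alpha k *: T k (z k)) @[k --> \oo] --> y.
  have -> : (fun k => alpha k *: T k (z k)) =
            (fun k => alpha k *: T k x + T k (S k y0)).
    apply/funext => k.
    by rewrite linearD linearZ scalerDr scalerA divff // scale1r.
  rewrite -[y in _ --> y]add0r.
  exact: topological_cvgD (alphaT_0 x X0x) (TS_id y0).
have : \forall k \near \oo, U (z k) /\ V (alpha k *: T k (z k)).
  apply: filterI; first exact: z_x (open_nbhs_nbhs (conj U_open Ux)).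
  exact: Tz_y (open_nbhs_nbhs (conj V_open Vy)).
move=> [k _ /(_ k (leqnn k))[Uzk VTzk]].
exists (z k) => //; exists (alpha k *: T k (z k)); split => //.
by exists (fun x => alpha k *: T k x) => //; exists (alpha k), (T k).
Qed.

End Codisk.

Theorem theorem3p22 (R : realType) (X : topologicalLmodType R[i])
    (X_second_countable : @second_countable X) (X_baire : baire_space X)
    (Gamma : set {linear X -> X}) (Gamma_sub : Gamma `<=` continuous_operators)
    (Gamma_criterion : codiskcyclicity_criterion Gamma) :
  dense (codiskcyclic_vectors Gamma) /\ codiskcyclic Gamma.
Proof.
have UC_dense : dense (codiskcyclic_vectors Gamma).
  have -> : codiskcyclic_vectors Gamma =
            [set x | dense (map_orbit (codisk_maps Gamma) x)].
    by apply/funext => x; rewrite /codiskcyclic_vectors /= codisk_orbitE.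
  apply: transitive_dense_orbits => //; first exact: codisk_maps_continuous.
  exact: criterion_transitive.
split=> //.
have [x [_ UCx]] := UC_dense setT (ex_intro _ 0 I) openT.
by exists x.
Qed.
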